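(* Let $R$ be a two-sided Noetherian ring and $n\ge 0$ an integer. Then $R$ is $n$-Gorenstein if and only if $R$ satisfies condition $(G_n)$, i.e. if and only if $$\operatorname{occ}_R(I)\ \ge\ \min\{n,\operatorname{fdim}_R I\}$$ for every indecomposable injective left $R$-module $I$.
   Context: All modules are left modules. $\operatorname{fdim}_R$ denotes flat dimension (possibly $\infty$). Let $0\to R\to I^0(R)\to I^1(R)\to\cdots$ be a minimal injective coresolution of the left $R$-module $R$. The ring $R$ is called $n$-Gorenstein if $\operatorname{fdim}_R I^g(R)\le g$ for all $0\le g<n$ (so every such ring is $0$-Gorenstein). For an indecomposable injective $R$-module $I$, the occurrence degree is $\operatorname{occ}_R(I)=\min\{i\ge 0\mid I \text{ is a direct summand of } I^i(R)\}$, with $\min\emptyset=\infty$; $n<\infty$ for every integer $n$. *)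

(* Defs.v *)
From HB Require Import structures.
From mathcomp Require Import all_boot all_order all_algebra.
From mathcomp Require Import boolp.

Set Implicit Arguments.
Unset Strict Implicit.
Unset Printing Implicit Defensive.

Import Order.TTheory GRing.Theory.

Local Open Scope ring_scope.
Local Open Scope quotient_scope.

Inductive enat := Fin of nat | Infty.

Definition option_of_enat (x : enat) := if x is Fin n then Some n else None.
Definition enat_of_option (x : option nat) := if x is Some n then Fin n else Infty.
Lemma option_of_enatK : cancel option_of_enat enat_of_option.
Proof. by case. Qed.
HB.instance Definition _ := Choice.copy enat (can_type option_of_enatK).

Fact enat_display : Order.disp_t. Proof. exact: Order.Disp tt tt. Qed.

Definition le_enat (x y : enat) : bool :=
  match x, y with
  | Fin m, Fin n => (m <= n)%N
  | _, Infty => true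
  | Infty, Fin _ => false
  end.

Lemma le_enat_refl : reflexive le_enat.
Proof. by case=> /=. Qed.

Lemma le_enat_anti : antisymmetric le_enat.
Proof. by move=> [m|] [n|] //= /anti_leq ->. Qed.

Lemma le_enat_trans : transitive le_enat.
Proof. by move=> [n|] [m|] [p|] //=; apply: leq_trans. Qed.

Lemma le_enat_total : total le_enat.
Proof. by move=> [m|] [n|] //=; apply: leq_total. Qed.

HB.instance Definition _ := Order.Le_isPOrder.Build enat_display enat
  le_enat_refl le_enat_anti le_enat_trans.
HB.instance Definition _ :=
  Order.POrder_isTotal.Build enat_display enat le_enat_total.

Lemma le_FinE m n : (Fin m <= Fin n)%O = (m <= n)%N. Proof. by []. Qed.
Lemma le_Infty (x : enat) : (x <= Infty)%O. Proof. by case: x. Qed.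
Lemma Infty_leF n : (Infty <= Fin n)%O = false. Proof. by []. Qed.

(* The minimum of a set of natural numbers, with [min set0 = Infty]. *)
Definition emin (P : nat -> Prop) : enat :=
  match pselect (exists n, `[< P n >]) with
  | left exP => Fin (ex_minn exP)
  | right _ => Infty
  end.

Variant emin_spec (P : nat -> Prop) : enat -> Prop :=
| EminFin n of P n & (forall m, P m -> (n <= m)%N) : emin_spec P (Fin n)
| EminInfty of (forall m, ~ P m) : emin_spec P Infty.

Lemma eminP (P : nat -> Prop) : emin_spec P (emin P).
Proof.
rewrite /emin; case: pselect => [exP|nP].
  case: ex_minnP => n /asboolP Pn minn; constructor => // m Pm.
  by apply: minn; apply/asboolP.
by constructor => m Pm; apply: nP; exists m; apply/asboolP.
Qed.

(* Right R-modules are left modules over the converse ring [R^c]. *)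

Definition exact (R : pzRingType) (A B C : lmodType R)
    (f : {linear A -> B}) (g : {linear B -> C}) : Prop :=
  forall y : B, g y = 0 <-> exists x : A, f x = y.

Definition surjective (A B : Type) (f : A -> B) : Prop :=
  forall y, exists x, f x = y.

Definition noetherian_module (R : pzRingType) (M : lmodType R) : Prop :=
  forall N : nat -> {pred M},
    (forall i, GRing.submod_closed (N i)) ->
    (forall i, {subset N i <= N i.+1}) ->
    exists k, forall i, (k <= i)%N -> N i =i N k.

Definition left_noetherian (R : pzRingType) : Prop :=
  noetherian_module (R^o : lmodType R).

Definition right_noetherian (R : pzRingType) : Prop :=
  noetherian_module ((R^c)^o : lmodType R^c).

Definition injective_module (R : pzRingType) (E : lmodType R) : Prop :=
  forall (A B : lmodType R) (f : {linear A -> B}) (g : {linear A -> E}),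
    injective f -> exists h : {linear B -> E}, forall a, h (f a) = g a.

Definition essential_image (R : pzRingType) (A M : lmodType R)
    (f : {linear A -> M}) : Prop :=
  forall N : {pred M}, GRing.submod_closed N ->
    (exists2 x, x \in N & x != 0) -> exists2 a, f a \in N & f a != 0.

Definition direct_summand (R : pzRingType) (I M : lmodType R) : Prop :=
  exists (N : lmodType R) (f : {linear (I * N)%type -> M}), bijective f.

Definition indecomposable (R : pzRingType) (M : lmodType R) : Prop :=
  (exists x : M, x != 0) /\
  forall (A B : lmodType R) (f : {linear (A * B)%type -> M}), bijective f ->
    (forall a : A, a = 0) \/ (forall b : B, b = 0).

Section Tensor.
Variables (R : pzRingType) (A : lmodType R^c) (M : lmodType R).

(* A sequence of pairs (a, m) stands for the sum of the a (x) m.  The quotient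
   monoid is a group, the opposite of a (x) m being (- a) (x) m. *)
Inductive tensor_eq : seq (A * M) -> seq (A * M) -> Prop :=
| TensorRefl s : tensor_eq s s
| TensorSym s t of tensor_eq s t : tensor_eq t s
| TensorTrans s t u of tensor_eq s t & tensor_eq t u : tensor_eq s u
| TensorCat s s' t t' of tensor_eq s s' & tensor_eq t t' :
    tensor_eq (s ++ t) (s' ++ t')
| TensorC s t : tensor_eq (s ++ t) (t ++ s)
| TensorDl a a' m : tensor_eq [:: (a + a', m)] [:: (a, m); (a', m)]
| TensorDr a m m' : tensor_eq [:: (a, m + m')] [:: (a, m); (a, m')]
| TensorZ (r : R) a m : (* [(r : R^c) *: a] is the right action [a r] *)
    tensor_eq [:: ((r : R^c) *: a, m)] [:: (a, r *: m)]
| Tensor0 a : tensor_eq [:: (a, 0)] [::].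

Definition tensor_eqb (s t : seq (A * M)) : bool := `[< tensor_eq s t >].

Lemma tensor_eqb_refl : reflexive tensor_eqb.
Proof. by move=> s; apply/asboolP; apply: TensorRefl. Qed.

Lemma tensor_eqb_sym : symmetric tensor_eqb.
Proof. by move=> s t; apply/asboolP/asboolP; apply: TensorSym. Qed.

Lemma tensor_eqb_trans : transitive tensor_eqb.
Proof.
by move=> t s u /asboolP st /asboolP tu; apply/asboolP; apply: TensorTrans tu.
Qed.

Canonical tensor_equiv :=
  EquivRel tensor_eqb tensor_eqb_refl tensor_eqb_sym tensor_eqb_trans.

Definition tensor := {eq_quot tensor_eqb}.

HB.instance Definition _ := Choice.on tensor.
HB.instance Definition _ := EqQuotient.on tensor.

Lemma tensor_piP s t : reflect (tensor_eq s t) (\pi_tensor s == \pi_tensor t).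
Proof. by rewrite piE; apply: asboolP. Qed.

Lemma tensor_reprP s : tensor_eq (repr (\pi_tensor s)) s.
Proof. by apply/tensor_piP; rewrite reprK. Qed.

Lemma tensor_eq0l (m : M) : tensor_eq [:: (0, m)] [::].
Proof.
have -> : (0 : A) = (0 : R^c) *: 0 by rewrite scale0r.
apply: TensorTrans (TensorZ 0 0 m) _.
by rewrite scale0r; apply: Tensor0.
Qed.

Definition seq_opp (s : seq (A * M)) := [seq (- p.1, p.2) | p <- s].

Lemma tensor_eq_oppK s : tensor_eq (seq_opp s ++ s) [::].
Proof.
elim: s => [|[a m] s IHs] /=; first exact: TensorRefl.
have -> : (- a, m) :: (seq_opp s ++ (a, m) :: s)
        = [:: (- a, m)] ++ ((seq_opp s ++ [:: (a, m)]) ++ s).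
  by rewrite /= -catA.
have swap : tensor_eq ([:: (- a, m)] ++ ((seq_opp s ++ [:: (a, m)]) ++ s))
                      ([:: (- a, m)] ++ (([:: (a, m)] ++ seq_opp s) ++ s)).
  by apply: TensorCat (TensorRefl _) (TensorCat (TensorC _ _) (TensorRefl _)).
apply: TensorTrans swap _.
apply: (@TensorCat [:: (- a, m); (a, m)] [::] _ [::]) IHs.
apply: TensorTrans (TensorSym (TensorDl _ _ _)) _.
by rewrite addNr; apply: tensor_eq0l.
Qed.

Lemma tensor_eq_opp s t : tensor_eq s t -> tensor_eq (seq_opp s) (seq_opp t).
Proof.
elim=> {s t}.
- by move=> s; apply: TensorRefl.
- by move=> s t _; apply: TensorSym.
- by move=> s t u _ st _; apply: TensorTrans.
- by move=> s s' t t' _ ss' _ tt'; rewrite /seq_opp !map_cat; apply: TensorCat.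
- by move=> s t; rewrite /seq_opp !map_cat; apply: TensorC.
- by move=> a a' m /=; rewrite opprD; apply: TensorDl.
- by move=> a m m'; apply: TensorDr.
- by move=> r a m /=; rewrite -scalerN; apply: TensorZ.
- by move=> a; apply: Tensor0.
Qed.

Definition tensor_zero : tensor := \pi_tensor [::].
Definition tensor_add (x y : tensor) : tensor := \pi_tensor (repr x ++ repr y).
Definition tensor_opp (x : tensor) : tensor := \pi_tensor (seq_opp (repr x)).

Lemma tensor_addE s t :
  tensor_add (\pi_tensor s) (\pi_tensor t) = \pi_tensor (s ++ t).
Proof.
by apply/eqP/tensor_piP; apply: TensorCat; apply: tensor_reprP.
Qed.

Lemma tensor_oppE s : tensor_opp (\pi_tensor s) = \pi_tensor (seq_opp s).
Proof. by apply/eqP/tensor_piP/tensor_eq_opp/tensor_reprP. Qed.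

Lemma tensor_addA : associative tensor_add.
Proof.
elim/quotW=> s; elim/quotW=> t; elim/quotW=> u.
by rewrite (tensor_addE t u) (tensor_addE s t) (tensor_addE s) (tensor_addE (s ++ t)) catA.
Qed.

Lemma tensor_addC : commutative tensor_add.
Proof.
elim/quotW=> s; elim/quotW=> t; rewrite (tensor_addE s t) (tensor_addE t s).
by apply/eqP/tensor_piP; apply: TensorC.
Qed.

Lemma tensor_add0 : left_id tensor_zero tensor_add.
Proof. by elim/quotW=> s; exact: (tensor_addE [::] s). Qed.

Lemma tensor_addN : left_inverse tensor_zero tensor_opp tensor_add.
Proof.
elim/quotW=> s; rewrite tensor_oppE tensor_addE.
by apply/eqP/tensor_piP; apply: tensor_eq_oppK.
Qed.

HB.instance Definition _ := GRing.isZmodule.Build tensor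
  tensor_addA tensor_addC tensor_add0 tensor_addN.

Definition pure (a : A) (m : M) : tensor := \pi_tensor [:: (a, m)].

Lemma pureDl a a' m : pure (a + a') m = pure a m + pure a' m.
Proof.
rewrite [RHS]tensor_addE; apply/eqP/tensor_piP; exact: TensorDl.
Qed.

Lemma pureDr a m m' : pure a (m + m') = pure a m + pure a m'.
Proof.
rewrite [RHS]tensor_addE; apply/eqP/tensor_piP; exact: TensorDr.
Qed.

Lemma pureZ (r : R) a m : pure ((r : R^c) *: a) m = pure a (r *: m).
Proof. by apply/eqP/tensor_piP; apply: TensorZ. Qed.

Lemma tensor_piE s : \pi_tensor s = \sum_(p <- s) pure p.1 p.2.
Proof.
elim: s => [|[a m] s IHs]; first by rewrite big_nil.
by rewrite big_cons -IHs [RHS]tensor_addE.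
Qed.

(* Together, the lemmas of this section are the universal property of A (x) M,
   which shows that [tensor_eq] has enough generators and no more. *)
Section Lift.
Variables (V : zmodType) (b : A -> M -> V).

Definition balanced : Prop :=
  [/\ forall a a' m, b (a + a') m = b a m + b a' m,
      forall a m m', b a (m + m') = b a m + b a m'
    & forall (r : R) a m, b ((r : R^c) *: a) m = b a (r *: m)].

Definition tensor_lift (x : tensor) : V := \sum_(p <- repr x) b p.1 p.2.

Hypothesis bal_b : balanced.

Lemma tensor_eq_sum s t :
  tensor_eq s t -> \sum_(p <- s) b p.1 p.2 = \sum_(p <- t) b p.1 p.2.
Proof.
have [bDl bDr bZ] := bal_b.
elim=> {s t} //=.
- by move=> s t u _ -> _ ->.
- by move=> s s' t t' _ ss' _ tt'; rewrite !big_cat /= ss' tt'.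
- by move=> s t; rewrite !big_cat /= addrC.
- by move=> a a' m; rewrite !big_cons big_nil /= bDl !addr0.
- by move=> a m m'; rewrite !big_cons big_nil /= bDr !addr0.
- by move=> r a m; rewrite !big_cons big_nil /= bZ.
move=> a; rewrite big_cons !big_nil /= addr0; apply: (@addrI _ (b a 0)).
by rewrite -bDr !addr0.
Qed.

Lemma tensor_lift_piE s :
  tensor_lift (\pi_tensor s) = \sum_(p <- s) b p.1 p.2.
Proof. exact/tensor_eq_sum/tensor_reprP. Qed.

Lemma tensor_lift_pure a m : tensor_lift (pure a m) = b a m.
Proof. by rewrite tensor_lift_piE big_cons big_nil addr0. Qed.

Lemma tensor_liftD : {morph tensor_lift : x y / x + y}.
Proof.
elim/quotW=> s; elim/quotW=> t.
by rewrite [_ + _ in LHS]tensor_addE !tensor_lift_piE big_cat.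
Qed.

Lemma tensor_lift_unique (h : tensor -> V) :
  {morph h : x y / x + y} -> (forall a m, h (pure a m) = b a m) ->
  h =1 tensor_lift.
Proof.
move=> hD hb; elim/quotW=> s; rewrite tensor_lift_piE tensor_piE.
elim: s => [|p s IHs].
  by rewrite !big_nil; apply: (@addrI _ (h 0)); rewrite -hD !addr0.
by rewrite !big_cons hD IHs hb.
Qed.

End Lift.
End Tensor.

(* [tensor_map M f] is f (x) id_M. *)
Definition tensor_map (R : pzRingType) (M : lmodType R) (A B : lmodType R^c)
    (f : {linear A -> B}) : tensor A M -> tensor B M :=
  tensor_lift (fun a m => pure (f a) m).
Arguments tensor_map {R} M {A B} f.

Section TensorMap.
Variables (R : pzRingType) (M : lmodType R) (A B : lmodType R^c).
Variable f : {linear A -> B}.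

Lemma tensor_map_balanced : balanced (fun (a : A) (m : M) => pure (f a) m).
Proof.
split=> *; first by rewrite raddfD pureDl.
- by rewrite pureDr.
- by rewrite linearZ; apply: pureZ.
Qed.

Lemma tensor_map_pure a m : tensor_map M f (pure a m) = pure (f a) m.
Proof. exact: tensor_lift_pure tensor_map_balanced _ _. Qed.

Lemma tensor_mapD : {morph tensor_map M f : x y / x + y}.
Proof. exact: tensor_liftD tensor_map_balanced. Qed.

End TensorMap.

Definition flat (R : pzRingType) (M : lmodType R) : Prop :=
  forall (A B : lmodType R^c) (f : {linear A -> B}),
    injective f -> injective (tensor_map M f).

Record flat_resolution (R : pzRingType) (M : lmodType R) := FlatResolution {
  fres_obj :> nat -> lmodType R;
  fres_d : forall i, {linear fres_obj i.+1 -> fres_obj i};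
  fres_aug : {linear fres_obj 0%N -> M};
  fres_flat : forall i, flat (fres_obj i);
  fres_surj : surjective fres_aug;
  fres_exact0 : exact (fres_d 0) fres_aug;
  fres_exact : forall i, exact (fres_d i.+1) (fres_d i)
}.

(* A resolution 0 -> F n -> ... -> F 0 -> M -> 0 is encoded as an infinite one
   whose terms vanish beyond n. *)
Definition has_flat_resolution (R : pzRingType) (M : lmodType R) (n : nat) :
    Prop :=
  exists F : flat_resolution M, forall i, (n < i)%N -> forall x : F i, x = 0.

Definition fdim (R : pzRingType) (M : lmodType R) : enat :=
  emin (has_flat_resolution M).

(* Minimality: I 0 is an injective hull of R, and I i.+1 is an injective hull of
   the cokernel of the previous map, which exactness identifies with the image
   of I i in I i.+1. *)
Record min_inj_coresolution (R : pzRingType) := MinInjCoresolution {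
  icores_obj :> nat -> lmodType R;
  icores_coaug : {linear R^o -> icores_obj 0%N};
  icores_d : forall i, {linear icores_obj i -> icores_obj i.+1};
  icores_injective : forall i, injective_module (icores_obj i);
  icores_inj : injective icores_coaug;
  icores_exact0 : exact icores_coaug (icores_d 0);
  icores_exact : forall i, exact (icores_d i) (icores_d i.+1);
  icores_min0 : essential_image icores_coaug;
  icores_min : forall i, essential_image (icores_d i)
}.

Definition n_gorenstein (R : pzRingType) (IR : min_inj_coresolution R)
    (n : nat) : Prop :=
  forall g, (g < n)%N -> (fdim (IR g) <= Fin g)%O.

Definition occ (R : pzRingType) (IR : min_inj_coresolution R)
    (I : lmodType R) : enat :=
  emin (fun i => direct_summand I (IR i)).

Definition condition_G (R : pzRingType) (IR : min_inj_coresolution R)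
    (n : nat) : Prop :=
  forall I : lmodType R, indecomposable I -> injective_module I ->
    (Order.min (Fin n) (fdim I) <= occ IR I)%O.

(* Main.v *)
(* Flat dimension at most g amounts to the vanishing of Tor_(g+1)(-, M), which
   passes to direct summands; this gives the implication from n-Gorenstein to
   (G_n).  For the converse, over a left Noetherian ring the union of a chain of
   direct summands of an injective module is again a direct summand.  Hence, for
   a nonzero element z of B (x) E, there is a direct summand D of E maximal such
   that z is not in the image of B (x) D; a complement of D is indecomposable,
   and z has a nonzero image in its tensor product with B.  So an element of a
   Tor group of E is detected by an indecomposable summand of E, and for
   E = I^g(R) such a summand has occurrence degree at most g. *)
From HB Require Import structures.
Require Import Defs.
From mathcomp Require Import all_boot all_order all_algebra.
From mathcomp Require Import boolp classical_sets functions.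

Set Implicit Arguments.
Unset Strict Implicit.
Unset Printing Implicit Defensive.

Import Order.TTheory GRing.Theory.

Local Open Scope ring_scope.

(** * Submodules and free modules *)

Section LinearMaps.
Variables (R : pzRingType).
Implicit Types A B C M N : lmodType R.

Definition linear_of A B (f : A -> B) (fL : linear f) : {linear A -> B} :=
  HB.pack f (GRing.isLinear.Build R A B *:%R f fL).

Lemma bij_linear_inv A B (f : {linear A -> B}) :
  bijective f -> exists2 g : {linear B -> A}, cancel f g & cancel g f.
Proof.
case=> g fK gK; have gL : linear g.
  by move=> a u v; apply: (can_inj fK); rewrite linearP !gK.
by exists (linear_of gL).
Qed.

Lemma linear0_inj A B (f : {linear A -> B}) :
  (forall x, f x = 0 -> x = 0) -> injective f.
Proof.
by move=> f0 x y fxy; apply: subr0_eq; apply: f0; rewrite linearB fxy subrr.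
Qed.

Section Submodule.
Variables (M : lmodType R) (N : {pred M}) (N_closed : GRing.submod_closed N).

Definition submodule of GRing.submod_closed N := {x : M | x \in N}.
Local Notation SM := (submodule N_closed).

HB.instance Definition _ := SubChoice.on SM.
HB.instance Definition _ :=
  GRing.SubChoice_isSubLmodule.Build R M N SM N_closed.

Definition submod_incl : {linear SM -> M} :=
  linear_of (@linearP _ _ _ _ (val : SM -> M)).

Definition to_submod x (xN : x \in N) : SM := exist (fun x => x \in N) x xN.

Lemma submod_incl_inj : injective submod_incl.
Proof. exact: val_inj. Qed.

Lemma submod_inclP (x : SM) : submod_incl x \in N.
Proof. exact: valP. Qed.

Lemma submod_corestr A (f : {linear A -> M}) : (forall a, f a \in N) ->
  exists g : {linear A -> SM}, forall a, submod_incl (g a) = f a.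
Proof.
move=> fN; pose g a : SM := Sub (f a) (fN a).
have gL : linear g.
  by move=> a u v; apply: val_inj; rewrite linearP !SubK linearP.
by exists (linear_of gL).
Qed.

End Submodule.

Lemma ker_closed A B (f : {linear A -> B}) :
  GRing.submod_closed [pred x | f x == 0].
Proof.
split=> [|a u v]; rewrite !inE ?linear0 // => /eqP fu /eqP fv.
by rewrite linearP fu fv scaler0 addr0.
Qed.

Definition kernel A B (f : {linear A -> B}) : lmodType R :=
  submodule (ker_closed f).
Definition ker_incl A B (f : {linear A -> B}) : {linear kernel f -> A} :=
  submod_incl (ker_closed f).

Lemma ker_incl_inj A B (f : {linear A -> B}) : injective (ker_incl f).
Proof. exact: submod_incl_inj. Qed.

Lemma ker_incl_exact A B (f : {linear A -> B}) : exact (ker_incl f) f.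
Proof.
move=> y; split=> [fy | [x <-]]; last exact/eqP/(submod_inclP x).
by have fyN : y \in [pred x | f x == 0] by [rewrite inE fy];
  exists (Sub y fyN).
Qed.

Lemma ker_lift A B C (f : {linear A -> B}) (h : {linear C -> A}) :
  (forall c, f (h c) = 0) ->
  exists g : {linear C -> kernel f}, forall c, ker_incl f (g c) = h c.
Proof. by move=> fh0; apply: submod_corestr => c; rewrite inE fh0. Qed.

End LinearMaps.

(** Only the nonzero terms count, and the lists of their indices in [s] and [t] are duplicate-free
    with the same members. Sums over a finite support thus do not depend on the list that bounds the
    support. *)
Lemma eq_big_supp (I : eqType) (V : nmodType) (F : I -> V) (s t : seq I) :
  uniq s -> uniq t -> (forall x, x \notin s -> F x = 0) ->
  (forall x, x \notin t -> F x = 0) -> \sum_(x <- s) F x = \sum_(x <- t) F x.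
Proof.
move=> us ut Fs Ft.
have big_nz r : \sum_(x <- r) F x = \sum_(x <- r | F x != 0) F x.
  by rewrite (bigID (fun x => F x == 0)) /= big1 ?add0r // => x /eqP.
rewrite !big_nz -2![LHS]big_filter -[RHS]big_filter.
apply/perm_big/uniq_perm; rewrite ?filter_uniq // => x.
rewrite !mem_filter; case: eqP => //= Fx.
have [xs|/Fs //] := boolP (x \in s); have [xt|/Ft //] := boolP (x \in t).
by [].
Qed.

(** * Free modules on an arbitrary choice type, with their universal property *)

Section Free.
Variables (R : pzRingType) (X : choiceType).

Definition finsupp : {pred X -> R^o} :=
  [pred f | `[< exists s : seq X, forall x, x \notin s -> f x = 0 >]].

Lemma finsupp_closed : GRing.submod_closed finsupp.
Proof.
split=> [|a f g]; first by apply/asboolP; exists [::].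
move=> /asboolP[s fs] /asboolP[t gt]; apply/asboolP; exists (s ++ t) => x.
rewrite mem_cat negb_or => /andP[/fs fx /gt gx].
by rewrite -[LHS]/(a *: f x + g x) fx gx scaler0 addr0.
Qed.

Definition free_module : lmodType R := submodule finsupp_closed.

Definition free_coord (x : X) (v : free_module) : R :=
  submod_incl finsupp_closed v x.

Lemma free_coordP x c u v :
  free_coord x (c *: u + v) = c * free_coord x u + free_coord x v.
Proof. by rewrite /free_coord linearP. Qed.

Lemma free_coord0 x : free_coord x 0 = 0.
Proof. by rewrite /free_coord linear0. Qed.

Lemma free_coordZ x c u : free_coord x (c *: u) = c * free_coord x u.
Proof. by rewrite -[c *: u]addr0 free_coordP free_coord0 addr0. Qed.

Lemma free_coordD x u v :
  free_coord x (u + v) = free_coord x u + free_coord x v.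
Proof. by rewrite -[u]scale1r free_coordP mul1r scale1r. Qed.

Lemma coord_eq u v : (forall x, free_coord x u = free_coord x v) -> u = v.
Proof.
by move=> uv; apply: (@submod_incl_inj _ _ _ finsupp_closed); apply/funext.
Qed.

Fact delta_finsupp y : (fun x => (x == y)%:R : R^o) \in finsupp.
Proof.
by apply/asboolP; exists [:: y] => x; rewrite inE => /negPf ->.
Qed.

Definition delta y : free_module :=
  to_submod finsupp_closed (delta_finsupp y).

Lemma coord_delta x y : free_coord x (delta y) = (x == y)%:R.
Proof. by []. Qed.

(** A sigma type rather than an existential, so that [free_lift_fun] can sum over the chosen
    support. *)
Lemma free_supp (v : free_module) :
  {s : seq X | uniq s & forall x, x \notin s -> free_coord x v = 0}.
Proof.
have /asboolP/cid[s vs] := submod_inclP v.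
exists (undup s); first exact: undup_uniq.
by move=> x; rewrite mem_undup => /vs.
Qed.

Lemma free_expand v s :
  uniq s -> (forall x, x \notin s -> free_coord x v = 0) ->
  v = \sum_(x <- s) free_coord x v *: delta x.
Proof.
move=> us vs; apply: coord_eq => y.
rewrite (big_morph _ (free_coordD y) (free_coord0 y)).
under eq_bigr do rewrite free_coordZ coord_delta.
have [ys | ys] := boolP (y \in s).
  rewrite (bigD1_seq y) //= big1 ?addr0 ?eqxx => [|x /negPf xy].
    by rewrite mulr1.
  by rewrite eq_sym xy mulr0.
rewrite vs // big_seq big1 // => x xs.
case: eqP => [yx|_]; last by rewrite mulr0.
by rewrite yx xs in ys.
Qed.

Section Lift.
Variables (M : lmodType R) (h : X -> M).

Definition free_lift_fun (v : free_module) : M :=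
  \sum_(x <- s2val (free_supp v)) free_coord x v *: h x.

Lemma free_lift_funE v s :
  uniq s -> (forall x, x \notin s -> free_coord x v = 0) ->
  free_lift_fun v = \sum_(x <- s) free_coord x v *: h x.
Proof.
rewrite /free_lift_fun; case: (free_supp v) => t ut vt /= us vs.
by apply: eq_big_supp => // x => [/vt|/vs] ->; rewrite scale0r.
Qed.

Fact free_lift_linear : linear free_lift_fun.
Proof.
move=> a u v; have [s us s0] := free_supp u; have [t ut t0] := free_supp v.
(* One list that bounds the supports of [u], [v] and [a *: u + v] at once. *)
pose r := undup (s ++ t); have ur : uniq r by exact: undup_uniq.
have u0 x : x \notin r -> free_coord x u = 0.
  by rewrite mem_undup mem_cat negb_or => /andP[/s0].
have v0 x : x \notin r -> free_coord x v = 0.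
  by rewrite mem_undup mem_cat negb_or => /andP[_ /t0].
rewrite !(@free_lift_funE _ r) // => [|x xr]; last first.
  by rewrite free_coordP u0 // v0 // mulr0 addr0.
rewrite scaler_sumr -big_split; apply: eq_bigr => x _.
by rewrite free_coordP scalerDl scalerA.
Qed.

Definition free_lift : {linear free_module -> M} := linear_of free_lift_linear.

Lemma free_lift_delta x : free_lift (delta x) = h x.
Proof.
rewrite [LHS](@free_lift_funE _ [:: x]) // => [|y]; last first.
  by rewrite inE coord_delta => /negPf ->.
by rewrite big_seq1 coord_delta eqxx scale1r.
Qed.

End Lift.
End Free.

Lemma free_cover_surj (R : pzRingType) (M : lmodType R) :
  surjective (free_lift (id : M -> M)).
Proof. by move=> m; exists (delta R m); rewrite free_lift_delta. Qed.

(** * Tensor products *)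

Section TensorTheory.
Variable R : pzRingType.

Section Induction.
Variables (A : lmodType R^c) (M : lmodType R).

Lemma tensor_ind (P : tensor A M -> Prop) :
  P 0 -> (forall x y, P x -> P y -> P (x + y)) ->
  (forall a m, P (pure a m)) -> forall x, P x.
Proof.
move=> P0 PD Pp; elim/quotW=> s; rewrite tensor_piE.
by elim/big_ind: _ => // i _.
Qed.

Lemma tensor_sumP (x : tensor A M) :
  exists s : seq (A * M), x = \sum_(p <- s) pure p.1 p.2.
Proof. by elim/quotW: x => s; exists s; apply: tensor_piE. Qed.

Lemma pure_sumr (a : A) (I : Type) (s : seq I) (F : I -> M) :
  pure a (\sum_(i <- s) F i) = \sum_(i <- s) pure a (F i).
Proof.
have p0 : pure a (0 : M) = 0.
  by apply: (@addrI _ (pure a 0)); rewrite -pureDr !addr0.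
exact: (big_morph _ (pureDr a) p0).
Qed.

Lemma pure_suml (I : Type) (s : seq I) (F : I -> A) (m : M) :
  pure (\sum_(i <- s) F i) m = \sum_(i <- s) pure (F i) m.
Proof.
have p0 : pure (0 : A) m = 0.
  by apply: (@addrI _ (pure 0 m)); rewrite -pureDl !addr0.
exact: (big_morph _ (fun a b => pureDl a b m) p0).
Qed.

End Induction.

Section Maps.
Variables (A B : lmodType R^c) (M N : lmodType R).

Fact tensor_map_is_additive (f : {linear A -> B}) :
  zmod_morphism (tensor_map M f).
Proof.
move=> x y; apply: (@addIr _ (tensor_map M f y)).
by rewrite -tensor_mapD !subrK.
Qed.
HB.instance Definition _ (f : {linear A -> B}) :=
  GRing.isZmodMorphism.Build _ _ (tensor_map M f) (tensor_map_is_additive f).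

Lemma tensor_map_zero (f : {linear A -> B}) : tensor_map M f 0 = 0.
Proof. exact: raddf0. Qed.

Definition tensor_mapr (f : {linear M -> N}) : tensor A M -> tensor A N :=
  tensor_lift (fun a m => pure a (f m)).

Fact tensor_mapr_balanced (f : {linear M -> N}) :
  balanced (fun (a : A) (m : M) => pure a (f m)).
Proof.
split=> *; first by rewrite pureDl.
- by rewrite raddfD pureDr.
- by rewrite linearZ; apply: pureZ.
Qed.

Lemma tensor_mapr_pure f a m : tensor_mapr f (pure a m) = pure a (f m).
Proof. exact: tensor_lift_pure (tensor_mapr_balanced f) _ _. Qed.

Lemma tensor_maprD f : {morph tensor_mapr f : x y / x + y}.
Proof. exact: tensor_liftD (tensor_mapr_balanced f). Qed.

Fact tensor_mapr_is_additive f : zmod_morphism (tensor_mapr f).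
Proof.
move=> x y; apply: (@addIr _ (tensor_mapr f y)).
by rewrite -tensor_maprD !subrK.
Qed.
HB.instance Definition _ (f : {linear M -> N}) :=
  GRing.isZmodMorphism.Build _ _ (tensor_mapr f) (tensor_mapr_is_additive f).

Lemma tensor_mapr_zero (f : {linear M -> N}) : tensor_mapr f 0 = 0.
Proof. exact: raddf0. Qed.

End Maps.
End TensorTheory.
Arguments tensor_mapr {R} A {M N} f.

(** * Right exactness of the tensor product; flatness of free modules *)

Section Exactness.
Variable R : pzRingType.

(** Computing modulo a subgroup [S] replaces a map into the quotient by [S]. In the applications [b]
    comes from a set-theoretic section of a surjection, so it is balanced only up to the image of a
    tensor map. *)
Lemma tensor_eq_sum_mod (A : lmodType R^c) (M : lmodType R) (V : zmodType)
    (S : V -> Prop) (b : A -> M -> V) :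
  S 0 -> (forall x y, S x -> S y -> S (x - y)) ->
  (forall a a' m, S (b (a + a') m - (b a m + b a' m))) ->
  (forall a m m', S (b a (m + m') - (b a m + b a m'))) ->
  (forall (r : R) a m, S (b ((r : R^c) *: a) m - b a (r *: m))) ->
  forall s t, tensor_eq s t ->
    S (\sum_(p <- s) b p.1 p.2 - \sum_(p <- t) b p.1 p.2).
Proof.
move=> S0 SB SDl SDr SZ.
have SN x : S x -> S (- x) by move=> Sx; rewrite -sub0r; apply: SB.
have SD x y : S x -> S y -> S (x + y).
  by move=> Sx Sy; rewrite -[y]opprK; apply: SB => //; apply: SN.
move=> s t; elim=> {s t} //=.
- by move=> s; rewrite subrr.
- by move=> s t _ Sst; rewrite -opprB; apply: SN.
- move=> s t u _ Sst _ Stu.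
  by rewrite -(subrKA (\sum_(p <- t) b p.1 p.2)); apply: SD.
- by move=> s s' t t' _ ss' _ tt'; rewrite !big_cat /= opprD addrACA; apply: SD.
- by move=> s t; rewrite !big_cat /= addrC subrr.
- by move=> a a' m; rewrite !big_cons big_nil /= !addr0; apply: SDl.
- by move=> a m m'; rewrite !big_cons big_nil /= !addr0; apply: SDr.
- by move=> r a m; rewrite !big_cons big_nil /= !addr0; apply: SZ.
move=> a; rewrite big_cons !big_nil /= addr0 subr0.
(* Additivity at [0 + 0] puts [- b a 0] in [S]. *)
by have /SN := SDr a 0 0; rewrite addr0 opprB addrK.
Qed.

Lemma sum_mod (V : zmodType) (S : V -> Prop) (I : Type) (s : seq I)
    (F G : I -> V) :
  S 0 -> (forall x y, S x -> S y -> S (x - y)) ->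
  (forall i, S (F i - G i)) -> S (\sum_(i <- s) F i - \sum_(i <- s) G i).
Proof.
move=> S0 SB SFG; rewrite -sumrB; apply: (big_ind S) => // x y Sx Sy.
by rewrite -[y]opprK; apply: (SB) => //; rewrite -sub0r; apply: SB.
Qed.

(** A set-theoretic section [r] of [q] induces an inverse of q (x) M modulo the image [S] of j (x)
    M: both the failure of [r] to be linear and the differences [p - r (q p)] lie in the kernel of
    [q], which is the image of [j]. *)
Lemma tensor_map_exact (M : lmodType R) (B P C : lmodType R^c)
    (j : {linear B -> P}) (q : {linear P -> C}) :
  exact j q -> surjective q -> forall x : tensor P M, tensor_map M q x = 0 ->
  exists y, tensor_map M j y = x.
Proof.
move=> jq /choice[r rK] x; pose S x := exists y, tensor_map M j y = x.
have S0 : S 0 by exists 0; rewrite raddf0.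
have SB y z : S y -> S z -> S (y - z).
  by move=> [y' <-] [z' <-]; exists (y' - z'); rewrite raddfB.
have Sp p m : q p = 0 -> S (pure p m).
  by move=> /jq[b <-]; exists (pure b m); rewrite tensor_map_pure.
have pB (p p' : P) (m : M) : pure p m - pure p' m = pure (p - p') m.
  by apply/eqP; rewrite subr_eq -pureDl subrK.
have [s ->] := tensor_sumP x.
pose qs := [seq (q p.1, p.2) | p <- s].
rewrite raddf_sum => qs0.
have /eqP/tensor_piP : \pi_(tensor C M)%qT qs = \pi_(tensor C M)%qT [::].
  rewrite -[RHS]/(0 : tensor C M) -[RHS]qs0 tensor_piE big_map.
  apply: eq_bigr => p _.
  by rewrite [RHS]tensor_map_pure.
move/(tensor_eq_sum_mod (S := S) (b := fun c m => pure (r c) m) S0 SB) => Sqs.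
have : S (\sum_(p <- s) pure p.1 p.2 - \sum_(p <- s) pure (r (q p.1)) p.2).
  by apply: sum_mod => // p; rewrite pB; apply: Sp; rewrite linearB rK subrr.
suff S1 : S (0 - \sum_(p <- s) pure (r (q p.1)) p.2).
  by move=> S2; have := SB _ _ S2 S1; rewrite opprB addrA subrK subr0.
apply: SB => //; rewrite big_map big_nil subr0 in Sqs; apply: Sqs.
- move=> a a' m; rewrite -pureDl pB; apply: Sp.
  by rewrite linearB linearD !rK subrr.
- by move=> a m m'; rewrite pureDr subrr.
- move=> c a m; rewrite -pureZ pB; apply: Sp.
  by rewrite linearB linearZ !rK subrr.
Qed.

(** The argument of [tensor_map_exact], with the section taken in the second factor. *)
Lemma tensor_mapr_exact (A : lmodType R^c) (L F M : lmodType R)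
    (l : {linear L -> F}) (p : {linear F -> M}) :
  exact l p -> surjective p -> forall x : tensor A F, tensor_mapr A p x = 0 ->
  exists y, tensor_mapr A l y = x.
Proof.
move=> lp /choice[r rK] x; pose S x := exists y, tensor_mapr A l y = x.
have S0 : S 0 by exists 0; rewrite raddf0.
have SB y z : S y -> S z -> S (y - z).
  by move=> [y' <-] [z' <-]; exists (y' - z'); rewrite raddfB.
have Sp a m : p m = 0 -> S (pure a m).
  by move=> /lp[b <-]; exists (pure a b); rewrite tensor_mapr_pure.
have pB (a : A) (m m' : F) : pure a m - pure a m' = pure a (m - m').
  by apply/eqP; rewrite subr_eq -pureDr subrK.
have [s ->] := tensor_sumP x.
pose ps := [seq (u.1, p u.2) | u <- s].
rewrite raddf_sum => ps0.
have /eqP/tensor_piP : \pi_(tensor A M)%qT ps = \pi_(tensor A M)%qT [::].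
  rewrite -[RHS]/(0 : tensor A M) -[RHS]ps0 tensor_piE big_map.
  apply: eq_bigr => u _.
  by rewrite [RHS]tensor_mapr_pure.
move/(tensor_eq_sum_mod (S := S) (b := fun a m => pure a (r m)) S0 SB) => Sps.
have : S (\sum_(u <- s) pure u.1 u.2 - \sum_(u <- s) pure u.1 (r (p u.2))).
  by apply: sum_mod => // u; rewrite pB; apply: Sp; rewrite linearB rK subrr.
suff S1 : S (0 - \sum_(u <- s) pure u.1 (r (p u.2))).
  by move=> S2; have := SB _ _ S2 S1; rewrite opprB addrA subrK subr0.
apply: SB => //; rewrite big_map big_nil subr0 in Sps; apply: Sps.
- by move=> a a' m; rewrite pureDl subrr.
- move=> a m m'; rewrite -pureDr pB; apply: Sp.
  by rewrite linearB linearD !rK subrr.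
- move=> c a m; rewrite pureZ pB; apply: Sp.
  by rewrite linearB linearZ !rK subrr.
Qed.

Lemma tensor_map_surj (M : lmodType R) (P C : lmodType R^c)
    (q : {linear P -> C}) :
  surjective q -> surjective (tensor_map M q).
Proof.
move=> /choice[r rK]; apply: tensor_ind => [|_ _ [x <-] [y <-]|c m].
- by exists 0; rewrite raddf0.
- by exists (x + y); rewrite raddfD.
by exists (pure (r c) m); rewrite tensor_map_pure rK.
Qed.

Lemma tensor_mapr_surj (A : lmodType R^c) (F M : lmodType R)
    (p : {linear F -> M}) :
  surjective p -> surjective (tensor_mapr A p).
Proof.
move=> /choice[r rK]; apply: tensor_ind => [|_ _ [x <-] [y <-]|a m].
- by exists 0; rewrite raddf0.
- by exists (x + y); rewrite raddfD.
by exists (pure a (r m)); rewrite tensor_mapr_pure rK.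
Qed.

Lemma tensor_map_mapr (A B : lmodType R^c) (M N : lmodType R)
    (f : {linear A -> B}) (g : {linear M -> N}) (x : tensor A M) :
  tensor_map N f (tensor_mapr A g x) = tensor_mapr B g (tensor_map M f x).
Proof.
elim/tensor_ind: x => [|x y xE yE|a m]; first by rewrite !raddf0.
  by rewrite !(tensor_mapD, tensor_maprD) xE yE.
by rewrite !(tensor_mapr_pure, tensor_map_pure).
Qed.

Lemma tensor_map_comp_eq (M : lmodType R) (A B C : lmodType R^c)
    (f : {linear A -> B}) (g : {linear B -> C}) (h : {linear A -> C}) :
  (forall a, g (f a) = h a) ->
  forall x, tensor_map M g (tensor_map M f x) = tensor_map M h x.
Proof.
move=> ghf; apply: tensor_ind => [|x y xE yE|a m]; first by rewrite !raddf0.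
  by rewrite !(tensor_mapD, tensor_maprD) xE yE.
by rewrite !tensor_map_pure ghf.
Qed.

Lemma tensor_mapr_comp_eq (A : lmodType R^c) (M N P : lmodType R)
    (f : {linear M -> N}) (g : {linear N -> P}) (h : {linear M -> P}) :
  (forall a, g (f a) = h a) ->
  forall x, tensor_mapr A g (tensor_mapr A f x) = tensor_mapr A h x.
Proof.
move=> ghf; apply: tensor_ind => [|x y xE yE|a m]; first by rewrite !raddf0.
  by rewrite !(tensor_mapD, tensor_maprD) xE yE.
by rewrite !tensor_mapr_pure ghf.
Qed.

Lemma tensor_mapr_id (A : lmodType R^c) (M : lmodType R) (f : {linear M -> M}) :
  (forall m, f m = m) -> forall x, tensor_mapr A f x = x.
Proof.
move=> fE; apply: tensor_ind => [|x y xE yE|a m]; first by rewrite raddf0.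
  by rewrite !(tensor_mapD, tensor_maprD) xE yE.
by rewrite tensor_mapr_pure fE.
Qed.

Lemma tensor_map0 (M : lmodType R) (A B : lmodType R^c) (f : {linear A -> B}) :
  (forall a, f a = 0) -> forall x, tensor_map M f x = 0.
Proof.
move=> f0; apply: tensor_ind => [|x y xE yE|a m]; first by rewrite raddf0.
  by rewrite !(tensor_mapD, tensor_maprD) xE yE addr0.
by rewrite tensor_map_pure f0; apply/eqP/tensor_piP/tensor_eq0l.
Qed.

Lemma tensor_mapr0 (A : lmodType R^c) (M N : lmodType R) (f : {linear M -> N}) :
  (forall a, f a = 0) -> forall x, tensor_mapr A f x = 0.
Proof.
move=> f0; apply: tensor_ind => [|x y xE yE|a m]; first by rewrite raddf0.
  by rewrite !(tensor_mapD, tensor_maprD) xE yE addr0.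
by rewrite tensor_mapr_pure f0; apply/eqP/tensor_piP/Tensor0.
Qed.

Fact tensor_lift_zmod_morphism (A : lmodType R^c) (M : lmodType R)
    (V : zmodType) (b : A -> M -> V) :
  balanced b -> zmod_morphism (tensor_lift b).
Proof.
move=> bP x y; apply: (@addIr _ (tensor_lift b y)).
by rewrite -(tensor_liftD bP) !subrK.
Qed.

Definition tensor_liftA (A : lmodType R^c) (M : lmodType R) (V : zmodType)
    (b : A -> M -> V) (bP : balanced b) : {additive tensor A M -> V} :=
  HB.pack (tensor_lift b)
    (GRing.isZmodMorphism.Build _ _ (tensor_lift b)
      (tensor_lift_zmod_morphism bP)).

Definition rflat (P : lmodType R^c) : Prop :=
  forall (M N : lmodType R) (f : {linear M -> N}),
    injective f -> injective (tensor_mapr P f).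

Lemma additive0_inj (V W : zmodType) (f : {additive V -> W}) :
  (forall x, f x = 0 -> x = 0) -> injective f.
Proof.
by move=> f0 x y fxy; apply: subr0_eq; apply: f0; rewrite raddfB fxy subrr.
Qed.

(** An element of A (x) F is determined by its coordinates in [A], and taking coordinates commutes
    with [f]. If f (x) F kills an element, then [f] kills each coordinate, so each coordinate is
    zero. *)
Lemma free_flat (X : choiceType) : flat (free_module R X).
Proof.
pose F := free_module R X.
have bal (A : lmodType R^c) x :
    balanced (fun (a : A) (v : F) => (free_coord x v : R^c) *: a).
  split=> [a a' v|a v v'|r a v]; first exact: scalerDr.
    by rewrite free_coordD scalerDl.
  by rewrite free_coordZ scalerA.
pose c A x := tensor_liftA (bal A x).
have cE A x a v : c A x (pure a v) = (free_coord x v : R^c) *: a.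
  exact: tensor_lift_pure (bal A x) a v.
(* Allowing every larger list [t] lets the induction treat a sum of two tensors over a common
   list. *)
have c_expand A (z : tensor A F) : exists s : seq X, forall t, uniq t ->
    {subset s <= t} -> z = \sum_(x <- t) pure (c A x z) (delta R x).
  elim/tensor_ind: z => [|z z' [s zE] [s' z'E]|a v].
  - exists [::] => t _ _; rewrite big1 // => x _; rewrite raddf0.
    exact/eqP/tensor_piP/tensor_eq0l.
  - exists (s ++ s') => t ut st; rewrite {1}(zE t) // => [|x xs]; last first.
      by apply: st; rewrite mem_cat xs.
    rewrite {1}(z'E t) // => [|x xs]; last first.
      by apply: st; rewrite mem_cat xs orbT.
    by rewrite -big_split; apply: eq_bigr => x _; rewrite raddfD pureDl.
  have [s us s0] := free_supp v; exists s => t ut st.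
  have t0 x : x \notin t -> free_coord x v = 0.
    by move=> xt; apply/s0/(contra (st x)).
  rewrite {1}(free_expand ut t0) pure_sumr; apply: eq_bigr => x _.
  by rewrite cE pureZ.
move=> A B f f_inj; apply: additive0_inj => z fz0.
have cf x y : c B x (tensor_map F f y) = f (c A x y).
  elim/tensor_ind: y => [|y y' yE y'E|a v]; first by rewrite !raddf0.
    by rewrite !raddfD yE y'E.
  by rewrite tensor_map_pure !cE linearZ.
have [s zE] := c_expand A z.
rewrite (zE (undup s)) ?undup_uniq // => [|x]; last by rewrite mem_undup.
rewrite big1 // => x _.
suff -> : c A x z = 0 by exact/eqP/tensor_piP/tensor_eq0l.
by apply: f_inj; rewrite -cf fz0 !raddf0.
Qed.

(** The coordinate argument of [free_flat], with the free module as the right factor ring-wise and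
    coordinates taken in the left module. *)
Lemma free_rflat (X : choiceType) : rflat (free_module R^c X).
Proof.
pose P := free_module R^c X.
have bal (M : lmodType R) x :
    balanced (fun (v : P) (m : M) => (free_coord x v : R) *: m).
  split=> [v v' m|v m m'|r v m]; first by rewrite free_coordD scalerDl.
    exact: scalerDr.
  by rewrite free_coordZ scalerA.
pose c M x := tensor_liftA (bal M x).
have cE M x v m : c M x (pure v m) = (free_coord x v : R) *: m.
  exact: tensor_lift_pure (bal M x) v m.
have c_expand M (z : tensor P M) : exists s : seq X, forall t, uniq t ->
    {subset s <= t} -> z = \sum_(x <- t) pure (delta R^c x : P) (c M x z).
  elim/tensor_ind: z => [|z z' [s zE] [s' z'E]|v m].
  - exists [::] => t _ _; rewrite big1 // => x _; rewrite raddf0.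
    exact/eqP/tensor_piP/Tensor0.
  - exists (s ++ s') => t ut st; rewrite {1}(zE t) // => [|x xs]; last first.
      by apply: st; rewrite mem_cat xs.
    rewrite {1}(z'E t) // => [|x xs]; last first.
      by apply: st; rewrite mem_cat xs orbT.
    by rewrite -big_split; apply: eq_bigr => x _; rewrite raddfD pureDr.
  have [s us s0] := free_supp v; exists s => t ut st.
  have t0 x : x \notin t -> free_coord x v = 0.
    by move=> xt; apply/s0/(contra (st x)).
  rewrite {1}(free_expand ut t0) pure_suml; apply: eq_bigr => x _.
  by rewrite cE pureZ.
move=> M N f f_inj; apply: additive0_inj => z fz0.
have cf x y : c N x (tensor_mapr P f y) = f (c M x y).
  elim/tensor_ind: y => [|y y' yE y'E|v m]; first by rewrite !raddf0.
    by rewrite !raddfD yE y'E.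
  by rewrite tensor_mapr_pure !cE linearZ.
have [s zE] := c_expand M z.
rewrite (zE (undup s)) ?undup_uniq // => [|x]; last by rewrite mem_undup.
rewrite big1 // => x _.
suff -> : c M x z = 0 by exact/eqP/tensor_piP/Tensor0.
by apply: f_inj; rewrite -cf fz0 !raddf0.
Qed.

End Exactness.

(** * Flat dimension *)

Section FlatDimension.
Variable R : pzRingType.

(* [j] is the inclusion of a (g+1)-st syzygy B of some right module, the terms
   of the resolution being flat, so that the kernel of [tensor_map M j] is
   Tor_(g+1) of that module with M. *)
Fixpoint syzygy (g : nat) (B P : lmodType R^c) (j : {linear B -> P}) : Prop :=
  [/\ injective j, rflat P &
   if g is g'.+1 then
     exists (C P' : lmodType R^c) (q : {linear P -> C}) (i : {linear C -> P'}),
       [/\ surjective q, exact j q & syzygy g' i]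
   else True].

Definition tor_vanishes (g : nat) (M : lmodType R) : Prop :=
  forall (B P : lmodType R^c) (j : {linear B -> P}), syzygy g j ->
    injective (tensor_map M j).

Lemma syzygy_inj g (B P : lmodType R^c) (j : {linear B -> P}) :
  syzygy g j -> injective j.
Proof. by case: g => [|g] []. Qed.

Lemma syzygy_rflat g (B P : lmodType R^c) (j : {linear B -> P}) :
  syzygy g j -> rflat P.
Proof. by case: g => [|g] []. Qed.

(** By naturality [s] maps the kernel for [M] into the kernel for [N], and it does so injectively
    because [r] induces a left inverse. *)
Lemma tor_vanishes_retract g (M N : lmodType R) (s : {linear M -> N})
    (r : {linear N -> M}) : cancel s r -> tor_vanishes g N -> tor_vanishes g M.
Proof.
move=> sK TN B P j jS; apply: additive0_inj => x jx.
have sx : tensor_mapr B s x = 0.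
  apply: (TN _ _ _ jS).
  by rewrite tensor_map_mapr jx !(tensor_map_zero, tensor_mapr_zero).
have rs m : r (s m) = (idfun : {linear M -> M}) m by exact: sK.
rewrite -(tensor_mapr_id (f := idfun) _ x) //.
by rewrite -(tensor_mapr_comp_eq rs) sx tensor_mapr_zero.
Qed.

Lemma flat_tor_vanishes0 (M : lmodType R) : flat M -> tor_vanishes 0 M.
Proof. by move=> Mflat B P j [j_inj _ _]; apply: Mflat. Qed.

(* Pulling [f : A -> B] back along a free cover [P] of [B] reduces flatness to
   submodules of free modules. *)
Lemma tor_vanishes0_flat (M : lmodType R) : tor_vanishes 0 M -> flat M.
Proof.
move=> TM A B f f_inj; apply: additive0_inj => x fx.
pose P := free_module R^c B; pose q : {linear P -> B} := free_lift id.
(* The kernel [A'] of this map is the pullback of [q] and [f]. *)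
have hL : linear (fun u : P * A => q u.1 - f u.2).
  move=> a u v; rewrite -[LHS]/(q (a *: u.1 + v.1) - f (a *: u.2 + v.2)).
  by rewrite (linearP q) (linearP f) scalerBr opprD addrACA.
pose h := linear_of hL; pose A' := kernel h.
have p1L : linear (fun u : A' => (ker_incl h u).1).
  by move=> a u v; rewrite linearP.
have p2L : linear (fun u : A' => (ker_incl h u).2).
  by move=> a u v; rewrite linearP.
pose p1 := linear_of p1L; pose p2 := linear_of p2L.
have qf u : q (p1 u) = f (p2 u).
  have : h (ker_incl h u) = 0 by apply/ker_incl_exact; exists u.
  by move/subr0_eq.
have p1_inj : injective p1.
  apply: linear0_inj => u pu; apply: (@ker_incl_inj _ _ _ h).
  have fu : p2 u = 0 by apply: f_inj; rewrite -qf pu !linear0.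
  rewrite linear0 [LHS]surjective_pairing.
  by rewrite -[(ker_incl h u).1]/(p1 u) -[(ker_incl h u).2]/(p2 u) pu fu.
have lift_A' b a : q b = f a -> exists u : A', p1 u = b /\ p2 u = a.
  move=> qb; have : h (b, a) = 0 by rewrite -[LHS]/(q b - f a) qb subrr.
  by move/ker_incl_exact => [u uE]; exists u; split;
    [rewrite -[LHS]/(ker_incl h u).1 uE | rewrite -[LHS]/(ker_incl h u).2 uE].
have p2_surj : surjective p2.
  move=> a; have [b qb] := free_cover_surj (f a).
  by have [u [_ <-]] := lift_A' _ _ qb; exists u.
(* The kernel of [q] embeds in the pullback as the pairs with second entry zero. *)
have kL : linear (fun k : kernel q => (ker_incl q k, 0 : A)).
  move=> a u v; rewrite linearP; congr (_, _).
  by rewrite /= scaler0 addr0.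
have [c|g gE] := @ker_lift _ _ _ _ h (linear_of kL).
  rewrite -[LHS]/(q (ker_incl q c) - f 0) linear0 subr0.
  by apply/ker_incl_exact; exists c.
have [x' x'E] := tensor_map_surj p2_surj x.
have : tensor_map M q (tensor_map M p1 x') = 0.
  rewrite (tensor_map_comp_eq (h := (f \o p2))) //.
  by rewrite -(tensor_map_comp_eq (f := p2) (g := f)) // x'E.
move/(tensor_map_exact (@ker_incl_exact _ _ _ q) (@free_cover_surj _ B)).
move=> [z zE].
have p1g k : p1 (g k) = ker_incl q k by rewrite -[LHS]/(ker_incl h (g k)).1 gE.
have p2g k : p2 (g k) = 0 by rewrite -[LHS]/(ker_incl h (g k)).2 gE.
(* Both sides agree after [p1], which embeds [A'] in a free module. As [p2] vanishes on the image of
   [g], this gives [x = 0]. *)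
have x'g : x' = tensor_map M g z.
  apply: (TM _ _ p1); first by split => //; apply: free_rflat.
  by rewrite -zE (tensor_map_comp_eq p1g).
rewrite -x'E x'g (tensor_map_comp_eq (h := (p2 \o g))) //.
by rewrite tensor_map0 // => k; apply: p2g.
Qed.

(** * Dimension shifting along a short exact sequence 0 -> L -> F -> M -> 0 with F flat *)

Section Shift.
Variables (g : nat) (L F M : lmodType R).
Variables (l : {linear L -> F}) (p : {linear F -> M}).
Hypotheses (F_flat : flat F) (l_inj : injective l).
Hypotheses (p_surj : surjective p) (lp : exact l p).

Let pl0 A (x : tensor A L) : tensor_mapr A p (tensor_mapr A l x) = 0.
Proof.
rewrite (tensor_mapr_comp_eq (h := (p \o l))) //.
by rewrite tensor_mapr0 // => a; apply/lp; exists a.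
Qed.

Let qj0 (B P C : lmodType R^c) (j : {linear B -> P}) (q : {linear P -> C}) N
  (x : tensor B N) : exact j q -> tensor_map N q (tensor_map N j x) = 0.
Proof.
move=> jq; rewrite (tensor_map_comp_eq (h := (q \o j))) //.
by rewrite tensor_map0 // => a; apply/jq; exists a.
Qed.

(** A diagram chase: lift [x] to [y] in B (x) F; its image in P (x) F comes from some [z] in P (x)
    L. The hypothesis on [L] kills [z] in C (x) L, so [z] comes from B (x) L. Flatness of [F] then
    puts [y] in the image of [l], which [p] kills. *)
Lemma tor_vanishes_syzygy : tor_vanishes g L -> tor_vanishes g.+1 M.
Proof.
move=> TL B P j [j_inj Pflat [C [P' [q [i [q_surj jq iS]]]]]].
apply: additive0_inj => x jx; have [y yE] := tensor_mapr_surj p_surj x.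
have : tensor_mapr P p (tensor_map F j y) = 0 by rewrite -tensor_map_mapr yE.
move/(tensor_mapr_exact lp p_surj) => [z zE].
have qz : tensor_map L q z = 0.
  (* As [P'] is flat, vanishing in P' (x) L can be checked in P' (x) F. *)
  apply: (TL _ _ _ iS); apply: (syzygy_rflat iS l_inj).
  rewrite -!tensor_map_mapr zE (qj0 _ jq).
  by rewrite !(tensor_map_zero, tensor_mapr_zero).
have [u uE] := tensor_map_exact jq q_surj qz.
have yu : y = tensor_mapr B l u.
  by apply: (F_flat j_inj); rewrite tensor_map_mapr uE zE.
by rewrite -yE yu pl0.
Qed.

(** A free cover of [C] prolongs the chain of syzygies by one step, so the hypothesis on [M] applies
    to the kernel [j] of the cover. The chase then runs through the same diagram from C (x) L back
    to B (x) L. *)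
Lemma tor_vanishes_cosyzygy : tor_vanishes g.+1 M -> tor_vanishes g L.
Proof.
move=> TM C P' i iS; apply: additive0_inj => w iw.
pose P := free_module R^c C; pose q : {linear P -> C} := free_lift id.
have q_surj : surjective q := @free_cover_surj _ C.
pose j := ker_incl q; have jq : exact j q := @ker_incl_exact _ _ _ q.
have jS : syzygy g.+1 j.
  split; [exact: ker_incl_inj | exact: free_rflat|].
  by exists C, P', q, i.
have lw : tensor_mapr C l w = 0.
  apply: (F_flat (syzygy_inj iS)).
  by rewrite tensor_map_mapr iw !(tensor_map_zero, tensor_mapr_zero).
have [z zE] := tensor_map_surj q_surj w.
have : tensor_map F q (tensor_mapr P l z) = 0 by rewrite tensor_map_mapr zE.
move/(tensor_map_exact jq q_surj) => [y yE].
have : tensor_mapr _ p y = 0.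
  by apply: (TM _ _ _ jS); rewrite tensor_map_mapr yE pl0 tensor_map_zero.
move/(tensor_mapr_exact lp p_surj) => [u uE].
have zu : z = tensor_map L j u.
  by apply: (syzygy_rflat jS l_inj); rewrite -tensor_map_mapr uE yE.
by rewrite -zE zu qj0.
Qed.

(** Splicing [F] in front of [G] raises degrees by one, so [G] has to vanish already in degree [n].
    The case [n = 0] is included: there [G] is zero throughout. *)
Lemma flat_resolution_cons n (G : flat_resolution L) :
  (forall i, (n <= i)%N -> forall x : G i, x = 0) -> has_flat_resolution M n.
Proof.
move=> Gn; pose obj i : lmodType R := if i is i'.+1 then G i' else F.
pose d0 : {linear G 0%N -> F} := l \o fres_aug G.
pose d i : {linear obj i.+1 -> obj i} :=
  match i with 0%N => d0 | i'.+1 => fres_d G i' end.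
have obj_flat i : flat (obj i) by case: i => [|i] //; apply: fres_flat.
have d0p : exact (d 0%N) p.
  move=> y; split=> [/lp[x <-]|[x <-]]; last by apply/lp; exists (fres_aug G x).
  by have [u <-] := fres_surj G x; exists u.
have d_exact i : exact (d i.+1) (d i).
  case: i => [|i]; last exact: fres_exact.
  move=> y; split=> [d0y|[x <-]].
    by apply/fres_exact0/l_inj; rewrite linear0.
  rewrite -[LHS]/(l (fres_aug G (fres_d G 0 x))).
  have -> : fres_aug G (fres_d G 0 x) = 0 by apply/fres_exact0; exists x.
  exact: linear0.
exists (@FlatResolution R M obj d p obj_flat p_surj d0p d_exact).
by case=> // i ni; apply: Gn.
Qed.

End Shift.

(** Induction on the length: the resolution without its first term resolves the kernel of the
    augmentation, and dimension shifting carries the vanishing back to [M]. In length zero the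
    augmentation is an isomorphism. *)
Lemma has_flat_resolution_tor n M : has_flat_resolution M n -> tor_vanishes n M.
Proof.
elim: n M => [|n IHn] M [F Fn].
  have aug_inj : injective (fres_aug F).
    apply: linear0_inj => x /fres_exact0[y <-].
    by rewrite (Fn 1%N isT y) linear0.
  have aug_bij : bijective (fres_aug F).
    have /choice[g gK] := fres_surj F.
    by exists g => // x; apply: aug_inj; rewrite gK.
  have [s _ sK] := bij_linear_inv aug_bij.
  apply: (tor_vanishes_retract sK).
  exact/flat_tor_vanishes0/fres_flat.
pose L := kernel (fres_aug F).
have [x|a aE] := @ker_lift _ _ _ _ (fres_aug F) (fres_d F 0).
  by apply/fres_exact0; exists x.
have a_surj : surjective a.
  move=> y; have /fres_exact0[x xE] : fres_aug F (ker_incl _ y) = 0.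
    by apply/ker_incl_exact; exists y.
  by exists x; apply: (@ker_incl_inj _ _ _ (fres_aug F)); rewrite aE.
have a_exact : exact (fres_d F 1) a.
  move=> y; rewrite -(@fres_exact _ _ F 0 y) -aE.
  split=> [->|ay0]; first exact: linear0.
  by apply: (@ker_incl_inj _ _ _ (fres_aug F)); rewrite ay0 linear0.
pose G := @FlatResolution R L (fun i => F i.+1) (fun i => fres_d F i.+1) a
  (fun i => @fres_flat _ _ F i.+1) a_surj a_exact
  (fun i => @fres_exact _ _ F i.+1).
apply: (tor_vanishes_syzygy (l := ker_incl (fres_aug F)) (p := fres_aug F)).
- exact: fres_flat.
- exact: ker_incl_inj.
- exact: fres_surj.
- exact: ker_incl_exact.
by apply: IHn; exists G => i ni; apply: (Fn i.+1).
Qed.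

(** Induction on [n]: dimension shifting along a free cover lowers [n] by one for the kernel of the
    cover, and a resolution of that kernel is spliced to the cover. *)
Lemma tor_has_flat_resolution n M : tor_vanishes n M -> has_flat_resolution M n.
Proof.
elim: n M => [|n IHn] M TM.
  (* The kernel of the identity serves as the zero module; [M], now flat, is resolved by itself
     followed by zeros. *)
  pose Z := kernel (idfun : {linear M -> M}).
  have Z0 (z : Z) : z = 0.
    apply: (@ker_incl_inj _ _ _ idfun); rewrite linear0.
    by apply/(@ker_incl_exact _ _ _ (idfun : {linear M -> M})); exists z.
  have Zflat : flat Z.
    move=> A B f _; apply: additive0_inj => x _.
    elim/tensor_ind: x => [//|x y -> ->|a m]; first by rewrite addr0.
    by rewrite (Z0 m); apply/eqP/tensor_piP/Tensor0.
  pose idZ : {linear Z -> Z} := idfun.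
  have Z_surj : surjective idZ by move=> z; exists z.
  have Z_exact : exact idZ idZ by move=> z; split=> _; [exists z|exact: Z0].
  pose G := @FlatResolution R Z (fun=> Z) (fun=> idZ) idZ (fun=> Zflat) Z_surj
    Z_exact (fun=> Z_exact).
  apply: (@flat_resolution_cons Z M M (ker_incl idfun) idfun _ _ _ _ 0 G).
  - exact: tor_vanishes0_flat.
  - exact: ker_incl_inj.
  - by move=> m; exists m.
  - exact: ker_incl_exact.
  - by move=> i _; apply: Z0.
pose p := free_lift (id : M -> M).
have F_flat : flat (free_module R M) := @free_flat _ _.
have p_surj : surjective p := @free_cover_surj _ M.
have k_inj := @ker_incl_inj _ _ _ p; have kp := @ker_incl_exact _ _ _ p.
have [G Gn] := IHn _ (tor_vanishes_cosyzygy F_flat k_inj p_surj kp TM).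
exact: (flat_resolution_cons F_flat k_inj p_surj kp (n := n.+1) (G := G) Gn).
Qed.

End FlatDimension.

(** * Injective modules over Noetherian rings *)

(** [Zorn_bigcup] also demands the union of the empty chain, so the empty set is adjoined to [P]. If
    the adjoined set turns out to be maximal, every member of [P] is empty and [A0] itself is
    maximal. *)
Lemma Zorn_bigcup_nonempty (T : Type) (P : set (set T)) (A0 : set T) :
  P A0 -> (forall F : set (set T), (F `<=` P)%classic -> total_on F subset ->
    (exists X, F X) -> P (\bigcup_(X in F) X)%classic) ->
  exists2 A, P A & forall B, (A `<=` B)%classic -> P B -> B = A.
Proof.
move=> PA0 PU; pose Q := [set A | A = set0 \/ P A]%classic.
have [F FQ Ftot | A [QA Amax]] := @Zorn_bigcup T Q; last first.
  have {}Amax B : (A `<=` B)%classic -> P B -> B = A.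
    move=> AB PB; apply: contrapT => BA; apply: (Amax B); last by right.
    by split=> // BA'; apply: BA; apply/seteqP.
  case: QA => [A_0|PA]; last by exists A.
  have eqA B : P B -> B = A by apply: Amax; rewrite A_0.
  by exists A0 => // B _ /eqA ->; rewrite (eqA A0).
have [[X [FX PX]]|noP] := pselect (exists X, F X /\ P X); [right | left].
  rewrite (_ : (\bigcup_(Y in F) Y = \bigcup_(Y in F `&` P) Y)%classic).
    apply: PU; [by move=> Y [] | | by exists X].
    by move=> Y Z [FY _] [FZ _]; apply: Ftot.
  apply/seteqP; split=> [x [Y FY Yx]|x [Y [FY _] Yx]]; exists Y => //.
  by split=> //; have [Y0|//] := FQ Y FY; rewrite Y0 in Yx.
apply/seteqP; split=> // x [Y FY Yx]; have [Y0|PY] := FQ Y FY.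
  by rewrite Y0 in Yx.
by apply: noP; exists Y.
Qed.

Section Injective.
Variable R : pzRingType.

(** Without a largest member, each [J t] fails to contain some [J (f t)], which contains [J t] by
    totality. Iterating [f] then gives an ascending chain that never stabilizes. *)
Lemma noetherian_chain_max (M : lmodType R) (T : Type) (J : T -> {pred M}) :
  noetherian_module M -> (forall t, GRing.submod_closed (J t)) ->
  (forall s t, {subset J s <= J t} \/ {subset J t <= J s}) -> T ->
  exists t, forall s, {subset J s <= J t}.
Proof.
move=> hM Jclosed Jtot t0; apply: contrapT => nomax.
have /choice[f fP] t : exists s, ~ {subset J s <= J t}.
  by apply: contrapT => nos; apply: nomax; exists t => s; apply: contrapT => st;
    apply: nos; exists s.
have f_sub t : {subset J t <= J (f t)} by have [/fP|] := Jtot (f t) t.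
have [k kmax] := hM (fun i => J (iter i f t0)) (fun i => Jclosed _)
  (fun i => f_sub _).
by apply: (fP (iter k f t0)) => x; rewrite -(kmax k.+1).
Qed.

Lemma injective_retract (M N : lmodType R) (s : {linear M -> N})
    (r : {linear N -> M}) :
  cancel s r -> injective_module N -> injective_module M.
Proof.
move=> sK Ninj A B f g f_inj.
have [h hf] := Ninj A B f (s \o g) f_inj.
by exists (r \o h) => a; rewrite /= hf /= sK.
Qed.

Lemma direct_summand_retract (I M : lmodType R) : direct_summand I M ->
  exists (s : {linear I -> M}) (r : {linear M -> I}), cancel s r.
Proof.
move=> [N [f /bij_linear_inv[g fK gK]]].
have sL : linear (fun i : I => f (i, 0 : N)).
  move=> a u v; rewrite -linearP; congr (f (_, _)).
  by rewrite /= scaler0 addr0.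
have rL : linear (fun m => (g m).1) by move=> a u v; rewrite linearP.
by exists (linear_of sL), (linear_of rL) => i; rewrite /= fK.
Qed.

Section Idempotent.
Variables (E : lmodType R) (p : {linear E -> E}).
Hypothesis p_idem : forall x, p (p x) = p x.

Lemma ker_proj : exists r : {linear E -> kernel p},
  forall x, ker_incl p (r x) = x - p x.
Proof.
have cL : linear (fun x => x - p x).
  by move=> a u v; rewrite linearP scalerBr opprD addrACA.
have [x|r rE] := @ker_lift _ _ _ _ p (linear_of cL); last by exists r.
by rewrite -[LHS]/(p (x - p x)) linearB p_idem subrr.
Qed.

Lemma ker_inclE i : p (ker_incl p i) = 0.
Proof. by apply/ker_incl_exact; exists i. Qed.

Lemma ker_projK (r : {linear E -> kernel p}) :
  (forall x, ker_incl p (r x) = x - p x) -> cancel (ker_incl p) r.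
Proof.
by move=> rE i; apply: (@ker_incl_inj _ _ _ p); rewrite rE ker_inclE subr0.
Qed.

End Idempotent.

(** The complement is the kernel of the complementary idempotent [e], that is, the image of [p]. *)
Lemma kernel_direct_summand (E : lmodType R) (p : {linear E -> E}) :
  (forall x, p (p x) = p x) -> direct_summand (kernel p) E.
Proof.
move=> p_idem; have cL : linear (fun x => x - p x).
  by move=> a u v; rewrite linearP scalerBr opprD addrACA.
pose e := linear_of cL; have eE x : e x = x - p x by [].
have e_idem x : e (e x) = e x by rewrite !eE linearB p_idem subrr subr0.
have [r rE] := ker_proj p_idem; have [r' rE'] := ker_proj e_idem.
have fL :
    linear (fun u : kernel p * kernel e => ker_incl p u.1 + ker_incl e u.2).
  move=> a u v.
  rewrite -[LHS]/(ker_incl p (a *: u.1 + v.1) + ker_incl e (a *: u.2 + v.2)).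
  by rewrite !linearP scalerDr addrACA.
exists (kernel e), (linear_of fL).
exists (fun x => (r x, r' x)) => [[i n]|x] /=.
  have pn : p (ker_incl e n) = ker_incl e n.
    by have /subr0_eq := ker_inclE n.
  congr (_, _); [apply: (@ker_incl_inj _ _ _ p)|apply: (@ker_incl_inj _ _ _ e)].
    by rewrite rE linearD ker_inclE pn add0r addrK.
  by rewrite rE' eE opprB addrC subrK linearD ker_inclE pn add0r.
rewrite -[LHS]/(ker_incl p (r x) + ker_incl e (r' x)).
by rewrite rE -eE rE' addrC subrK.
Qed.

(** The image of an idempotent [p]. As subsets of [E], summands can be ordered by inclusion and fed
    to Zorn's lemma. *)
Definition fixed_set (E : lmodType R) (p : {linear E -> E}) : set E :=
  [set x | p x = x]%classic.

(* Maximal partial retractions onto the union, represented by their graphs, are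
   total: this is the proof of Baer's criterion. *)
Lemma summand_chain_union (E : lmodType R) (F : set (set E)) :
  left_noetherian R -> injective_module E -> (exists X, F X) ->
  total_on F subset ->
  (forall X, F X -> exists2 p : {linear E -> E},
     forall x, p (p x) = p x & X = fixed_set p) ->
  exists2 p : {linear E -> E},
    forall x, p (p x) = p x & (\bigcup_(X in F) X)%classic = fixed_set p.
Proof.
move=> hl Einj [X0 FX0] Ftot Fsum; set U := (\bigcup_(X in F) X)%classic.
have X_lin X a x y : F X -> X x -> X y -> X (a *: x + y).
  move=> /Fsum[p _ ->]; rewrite /fixed_set /= => px py.
  by rewrite linearP px py.
have X_0 X : F X -> X 0 by move=> /Fsum[p _ ->]; rewrite /fixed_set /= linear0.
have U0 : U 0 by exists X0 => //; apply: X_0.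
have U_lin a x y : U x -> U y -> U (a *: x + y).
  move=> [X FX Xx] [Y FY Yy]; have [XY|YX] := Ftot X Y FX FY.
    by exists Y => //; apply: X_lin => //; apply: XY.
  by exists X => //; apply: X_lin => //; apply: YX.
(* Graphs of linear maps from a submodule containing [U] to [U] that are the identity on [U]; by
   linearity, being single-valued need only be asked at 0. *)
pose good (G : set (E * E)) := [/\ forall u, U u -> G (u, u),
  forall a x x' y y', G (x, y) -> G (x', y') -> G (a *: x + x', a *: y + y'),
  forall y, G (0, y) -> y = 0 & forall x y, G (x, y) -> U y].
have [||G [GU G_lin G_fun G_val] Gmax] :=
    @Zorn_bigcup_nonempty _ good [set u | U u.1 /\ u.1 = u.2]%classic.
- split=> [//|a x x' y y' /= [Ux <-] [Ux' <-]|y /= [_ <-]|x y /= [Ux <-]] //.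
  by split=> //; apply: U_lin.
- move=> H Hgood Htot [G0 HG0]; split.
  + by move=> u Uu; exists G0 => //; have [+ _ _ _] := Hgood _ HG0; apply.
  + move=> a x x' y y' [G1 H1 G1x] [G2 H2 G2x].
    have [_ lin1 _ _] := Hgood _ H1; have [_ lin2 _ _] := Hgood _ H2.
    have [G12|G21] := Htot _ _ H1 H2.
      by exists G2 => //; apply: lin2 => //; apply: G12.
    by exists G1 => //; apply: lin1 => //; apply: G21.
  + by move=> y [G1 H1 G1y]; have [_ _ + _] := Hgood _ H1; apply.
  + by move=> x y [G1 H1 G1y]; have [_ _ _ +] := Hgood _ H1; apply; apply: G1y.
have G0 : G (0, 0) by apply: GU.
have G_eq x y y' : G (x, y) -> G (x, y') -> y = y'.
  move=> Gy Gy'; have := G_lin (-1) _ _ _ _ Gy' Gy.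
  by rewrite !scaleN1r addNr => /G_fun; rewrite addrC => /subr0_eq.
have G_total x : exists y, G (x, y).
  pose FT := {X | F X}.
  (* The left ideal of those [r] for which the partial map is defined at [r *: x] with value in [X].
     These ideals form a chain, so by the Noetherian hypothesis one [X] contains all values on
     multiples of [x]. *)
  pose J (X : FT) : {pred R^o} :=
    [pred r : R^o | `[< exists2 y, sval X y & G ((r : R) *: x, y) >]].
  have JP X r : r \in J X -> exists2 y, sval X y & G ((r : R) *: x, y).
    by move/asboolP.
  have J_closed X : GRing.submod_closed (J X).
    split=> [|a r s /asboolP[y Xy Gy] /asboolP[y' Xy' Gy']]; apply/asboolP.
      by exists 0; [apply: X_0; apply: svalP | rewrite scale0r].
    exists (a *: y + y'); first by apply: X_lin => //; apply: svalP.
    by rewrite scalerDl -[a *: r]/(a * r) -scalerA; apply: G_lin.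
  have [|X JX] := noetherian_chain_max hl J_closed _ (exist _ _ FX0).
    have J_mono (X Y : FT) : (sval X `<=` sval Y)%classic ->
        {subset J X <= J Y}.
      move=> XY r /asboolP[y Xy Gy]; apply/asboolP.
      by exists y => //; apply: XY.
    by move=> X Y; have [/J_mono|/J_mono] := Ftot _ _ (svalP X) (svalP Y);
      [left|right].
  have GX r y : G (r *: x, y) -> r \in J X /\ sval X y.
    move=> Gy; have [Y FY Yy] := G_val _ _ Gy.
    have rJ : r \in J X.
      by apply: (JX (exist _ _ FY)); apply/asboolP; exists y.
    by split=> //; have /JP[y' Xy' /(G_eq _ _ _ Gy) ->] := rJ.
  pose JX_mod := submodule (J_closed X).
  have phi_ex (r : JX_mod) :
      exists y, G ((submod_incl (J_closed X) r : R) *: x, y).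
    by have /JP[y _ Gy] := @submod_inclP _ _ _ (J_closed X) r; exists y.
  have [phi phiP] := choice phi_ex.
  have phiL : linear phi.
    move=> a r s; apply: (G_eq _ _ _ (phiP _)).
    rewrite linearP scalerDl -[a *: _]/(a * _) -scalerA.
    exact: G_lin.
  have [h hE] :=
    Einj _ _ _ (linear_of phiL) (@submod_incl_inj _ _ _ (J_closed X)).
  have [p p_idem XE] := Fsum _ (svalP X).
  (* The extension [h] takes values in [E]; the projection [p] onto [X] brings the prospective image
     of [x] back into [U]. *)
  pose u := p (h 1).
  have Uu : U u by exists (sval X); [apply: svalP | rewrite XE; apply: p_idem].
  have Gu r y : G (r *: x, y) -> y = r *: u.
    move=> Gy; have [rJ Xy] := GX _ _ Gy.
    have py : p y = y by move: Xy; rewrite XE.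
    have -> : r *: u = p (h r).
      by rewrite /u -!linearZ; congr (p (h _)); apply: mulr1.
    rewrite -[r in h r]/(submod_incl (J_closed X) (to_submod (J_closed X) rJ)) hE.
    rewrite -[LHS]py.
    congr (p _).
    exact: (G_eq (r *: x) _ _ Gy (phiP (to_submod (J_closed X) rJ))).
  (* The graph [G] extended by sending [x] to [u]. *)
  pose G' := [set v | exists a b r,
    [/\ G (a, b), v.1 = a + r *: x & v.2 = b + r *: u]]%classic.
  have GG' : (G `<=` G')%classic.
    by move=> [a b] Gab; exists a, b, 0; rewrite !scale0r !addr0.
  have G'_good : good G'.
    split=> [v Uv|c v1 v2 w1 w2|y|v w].
    - exact/GG'/GU.
    - move=> [a [b [r [Gab /= -> ->]]]] [a' [b' [r' [Gab' /= -> ->]]]].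
      exists (c *: a + a'), (c *: b + b'), (c * r + r'); split=> /=.
      + exact: G_lin.
      + by rewrite scalerDr scalerDl scalerA addrACA.
      + by rewrite scalerDr scalerDl scalerA addrACA.
    (* If [a + r *: x = 0], then [a] is a multiple of [x] and [Gu] forces [b = - r *: u]. *)
    - move=> [a [b [r [Gab /= /esym/eqP + ->]]]].
      rewrite addr_eq0 -scaleNr => /eqP aE; rewrite aE in Gab.
      by rewrite (Gu _ _ Gab) scaleNr addNr.
    - move=> [a [b [r [Gab /= _ ->]]]]; rewrite addrC.
      by apply: U_lin => //; apply: G_val Gab.
  exists u; rewrite -(Gmax _ GG' G'_good).
  by exists 0, 0, 1; rewrite !scale1r !add0r.
have /choice[p pG] := G_total.
have pL : linear p.
  by move=> a x y; apply: (G_eq _ _ _ (pG _)); apply: G_lin.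
have pU u : U u -> p u = u by move=> Uu; apply: (G_eq _ _ _ (pG _)); apply: GU.
exists (linear_of pL) => [x|]; first by apply: pU; apply: G_val (pG x).
apply/seteqP; split=> [x /pU //|x]; rewrite /fixed_set /= => <-.
exact: G_val (pG x).
Qed.

(* For a nonzero [z] killed by a syzygy inclusion, take a summand [D] maximal
   among those with [z] outside the image of [B (x) D].  Its complement is
   indecomposable, since [D] is the intersection of [D + I1] and [D + I2] for
   any decomposition [I1 + I2] of the complement. *)
Lemma tor_vanishes_indecomposable (E : lmodType R) (g : nat) :
  left_noetherian R -> injective_module E ->
  (forall I : lmodType R, indecomposable I -> injective_module I ->
     direct_summand I E -> tor_vanishes g I) ->
  tor_vanishes g E.
Proof.
move=> hl Einj TI B P j jS; apply: additive0_inj => z jz.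
apply: contrapT => z0.
(* That [z] is outside the image of B (x) D is expressed as [z] not being fixed by the projection
   that [p] induces. *)
pose Q := [set X : set E | exists p : {linear E -> E},
  [/\ forall x, p (p x) = p x, X = fixed_set p & tensor_mapr B p z <> z]]%classic.
have zeroL : linear (fun _ : E => 0 : E).
  by move=> a u v; rewrite scaler0 addr0.
have [||X [p [p_idem XE pz]] Xmax] :=
    @Zorn_bigcup_nonempty _ Q (fixed_set (linear_of zeroL)).
- exists (linear_of zeroL); split=> //.
  by rewrite tensor_mapr0 // => /esym.
- move=> F FQ Ftot [X0 FX0].
  have [||p p_idem UE] := @summand_chain_union E F hl Einj _ Ftot.
  + by exists X0.
  + by move=> X /FQ[p [p_idem XE _]]; exists p.
  exists p; split=> // pz.
  (* Only finitely many elements [p u.2] occur in [z], so one member [X] of the chain contains them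
     all, and its projection would fix [z] as well. *)
  have [s sE] := tensor_sumP z.
  have [X FX Xs] : exists2 X, F X & forall u, u \in s -> X (p u.2).
    elim: s {sE} => [|v s [X FX Xs]]; first by exists X0.
    have : fixed_set p (p v.2) by apply: p_idem.
    rewrite -UE => -[Y FY Yv]; have [XY|YX] := Ftot _ _ FX FY.
      exists Y => // u; rewrite inE => /predU1P[->//|us].
      exact/XY/Xs.
    exists X => // u; rewrite inE => /predU1P[->|]; last exact: Xs.
    exact: YX.
  have [q [_ XE []]] := FQ _ FX.
  rewrite -pz sE ![tensor_mapr B p _]raddf_sum ![tensor_mapr B q _]raddf_sum.
  apply: eq_big_seq => u us; rewrite /= !tensor_mapr_pure; congr pure.
  by have := Xs _ us; rewrite XE.
have [r rE] := ker_proj p_idem; have rK := ker_projK rE.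
pose i := ker_incl p.
have pi x : p (i x) = 0 := ker_inclE x.
have rp x : r (p x) = 0.
  by apply: (@ker_incl_inj _ _ _ p); rewrite rE p_idem subrr linear0.
(* For an idempotent [c] of the complement, this is the projection onto the sum of the summand [X]
   and the image of [c]. *)
pose pc (c : kernel p -> kernel p) x := p x + i (c (r x)).
have pcL (c : {linear kernel p -> kernel p}) : linear (pc c).
  by move=> a u v; rewrite /pc !linearP scalerDr addrACA.
have pcE (c : {linear kernel p -> kernel p}) x :
  linear_of (pcL c) x = p x + i (c (r x)) by [].
(* A nonzero fixed point of [c] makes that sum strictly larger than [X], so maximality forces its
   projection to fix [z]. *)
have grow (c : {linear kernel p -> kernel p}) y : (forall x, c (c x) = c x) ->
    c y = y -> y <> 0 -> tensor_mapr B (linear_of (pcL c)) z = z.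
  move=> c_idem cy y0; apply: contrapT => cz.
  have E1 : fixed_set (linear_of (pcL c)) = X.
    apply: Xmax.
      move=> x; rewrite XE /fixed_set /= /pc => px.
      by rewrite -{2}px rp !linear0 addr0.
    exists (linear_of (pcL c)); split=> // x; rewrite /= /pc.
    by rewrite linearD p_idem pi addr0 linearD rp add0r rK c_idem.
  have : X (i y) by rewrite -E1 /fixed_set /= /pc pi add0r rK cy.
  rewrite XE => piy; apply: y0; apply: (@ker_incl_inj _ _ _ p).
  by rewrite linear0 -(pi y); apply: esym.
have I_inj : injective_module (kernel p) by apply: injective_retract Einj.
have I_ind : indecomposable (kernel p).
  split.
    apply: contrapT => no; apply: pz; apply: tensor_mapr_id => x.
    have rx : r x = 0.
      by apply: contrapT => rx; apply: no; exists (r x); apply/eqP.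
    by have := rE x; rewrite rx linear0 => /esym/subr0_eq/esym.
  move=> A A' f /bij_linear_inv[h fK hK].
  have [A0|nA] := pselect (forall a : A, a = 0); [by left | right => b].
  apply: contrapT => b0.
  have [a a0] : exists a : A, a <> 0.
    apply: contrapT => no; apply: nA => a.
    by apply: contrapT => a0; apply: no; exists a.
  have c1L : linear (fun x => f ((h x).1, 0 : A')).
    move=> t u v; rewrite -linearP linearP; congr (f (_, _)).
    by rewrite /= scaler0 addr0.
  have c2L : linear (fun x => f (0 : A, (h x).2)).
    move=> t u v; rewrite -linearP linearP; congr (f (_, _)).
    by rewrite /= scaler0 addr0.
  have f_nz u : u <> 0 -> f u <> 0.
    by move=> u0 fu; apply: u0; rewrite -[u]fK fu linear0.
  have z1 : tensor_mapr B (linear_of (pcL (linear_of c1L))) z = z.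
    apply: (grow _ (f (a, 0))) => [x||] /=; rewrite ?fK //.
    by apply: f_nz => -[].
  have z2 : tensor_mapr B (linear_of (pcL (linear_of c2L))) z = z.
    apply: (grow _ (f (0, b))) => [x||] /=; rewrite ?fK //.
    by apply: f_nz => -[].
  (* The projections onto the two factors compose to zero, so the two enlarged projections compose
     to [p], which would then fix [z]. *)
  apply: pz; rewrite -{2}z1 -{2}z2; apply/esym/tensor_mapr_comp_eq => x.
  have c12 y : linear_of c1L (linear_of c2L y) = 0.
    by rewrite -[LHS]/(f ((h (f (0, (h y).2))).1, 0)) fK; apply: (linear0 f).
  rewrite !pcE (linearD p) p_idem pi addr0.
  by rewrite (linearD r) rp add0r rK c12 linear0 addr0.
have TIker := TI _ I_ind I_inj (kernel_direct_summand p_idem).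
have rz : tensor_mapr B r z = 0.
  apply: (TIker _ _ _ jS).
  by rewrite tensor_map_mapr jz tensor_mapr_zero tensor_map_zero.
apply: pz.
have irL : linear (fun x => i (r x)) by move=> a u v; rewrite !linearP.
(* The identity of [E] is [p] plus the projection onto its kernel; the second part kills [z], so [p]
   fixes [z]. *)
have sum_z y : y = tensor_mapr B p y + tensor_mapr B (linear_of irL) y.
  elim/tensor_ind: y => [|x y xE yE|a m].
  - by rewrite !tensor_mapr_zero addr0.
  - by rewrite !tensor_maprD addrACA -xE -yE.
  - rewrite !tensor_mapr_pure -pureDr.
    by rewrite -[linear_of irL m]/(ker_incl p (r m)) rE addrC subrK.
rewrite {2}(sum_z z).
rewrite -(tensor_mapr_comp_eq (f := r) (g := i) (h := linear_of irL)) //.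
by rewrite rz tensor_mapr_zero addr0.
Qed.

End Injective.

(** * Equivalence of the n-Gorenstein property and condition (G_n) *)

Theorem theorem3p3 (R : pzRingType) (IR : min_inj_coresolution R) (n : nat)
    (hl : left_noetherian R) (hr : right_noetherian R) :
  n_gorenstein IR n <-> condition_G IR n.
Proof.
split=> [gor I _ _|condG g gn].
  rewrite /occ; case: eminP => [i Isum _|_]; last exact: le_Infty.
  have [s [r sK]] := direct_summand_retract Isum.
  (* For [n <= i] the bound by [n] suffices; for [i < n] the bound on the flat dimension of [IR i]
     passes to its summand [I]. *)
  rewrite ge_min; have [ni|/gor] := leqP n i; first by rewrite le_FinE ni.
  rewrite /fdim; case: eminP => // m /has_flat_resolution_tor TM _ mi.
  apply/orP; right; case: eminP => [k _ kmin|no].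
    apply: le_trans mi; rewrite le_FinE; apply: kmin.
    exact/tor_has_flat_resolution/(tor_vanishes_retract sK).
  case: (no m); exact/tor_has_flat_resolution/(tor_vanishes_retract sK).
suff TM : tor_vanishes g (IR g).
  rewrite /fdim; case: eminP => [k _ kmin|/(_ g) []].
    by rewrite le_FinE; apply: kmin; apply: tor_has_flat_resolution.
  exact: tor_has_flat_resolution.
apply: (tor_vanishes_indecomposable hl (@icores_injective _ IR g)).
move=> I Iind Iinj Isum.
have := condG I Iind Iinj.
(* As [I] is a summand of [IR g], its occurrence degree [k] is finite with [k <= g < n]. The minimum
   in the condition is therefore attained by the flat dimension of [I], which is at most [k]. *)
rewrite /occ; case: eminP => [k _ kmin|no]; last first.
  by case: (no g).
rewrite ge_min; have kg := kmin _ Isum.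
rewrite le_FinE leqNgt (leq_ltn_trans kg gn) /= /fdim.
case: eminP => // m [F Fm] _; rewrite le_FinE => mk.
apply: has_flat_resolution_tor; exists F => i gi; apply: Fm.
exact: leq_ltn_trans (leq_trans mk kg) gi.
Qed.
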